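(* Let $X$ be a real Banach space, $f\in\mathrm{Lip}_0(X)$, $\|f\|=1$, $\delta\in(0,2)$, and let $x,y\in X$, $x\neq y$, be such that $\frac{f(x)-f(y)}{\|x-y\|}>1-\delta$. Then for every $h\in\mathrm{Lip}_0(X)$ with $\|h\|=1$ and $\frac{h(x)-h(y)}{\|x-y\|}=1$, there exist $g\in\mathrm{Lip}_0(X)$ with $\|g\|=1$, $\|f-g\|<\sqrt{2\delta}$, and a sequence of pairs $\{(v_n,w_n)\}$ in $X\times X$ with $v_n\neq w_n$ for every $n$, such that $$\frac{h(v_n)-h(w_n)}{\|v_n-w_n\|}>1-\sqrt{2\delta}\ \text{ for all } n\in\mathbb{N}\quad\text{and}\quad \lim_{n\to\infty}\frac{g(v_n)-g(w_n)}{\|v_n-w_n\|}=1.$$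
   Context: $\mathrm{Lip}_0(X)$ is the Banach space of all Lipschitz functions $f:X\to\mathbb{R}$ with $f(0)=0$, with norm $\|f\|=\sup\left\{\frac{|f(x)-f(y)|}{\|x-y\|}: x,y\in X,\ x\neq y\right\}$. *)

(* Defs.v *)
From mathcomp Require Import all_boot all_order all_algebra.
From mathcomp Require Import all_classical all_reals all_analysis.

Set Implicit Arguments.
Unset Strict Implicit.
Unset Printing Implicit Defensive.

Import Order.TTheory GRing.Theory Num.Theory.
Import numFieldNormedType.Exports.

Local Open Scope classical_set_scope.
Local Open Scope ring_scope.

Definition Lip0 (R : realType) (X : normedModType R) : set (X -> R) :=
  [set f | lipschitz f /\ f 0 = 0].
Arguments Lip0 {R} X.

(* On [Lip0 X] the set below is bounded, so [sup] is the true supremum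
   (and 0 when X = {0}, where the set is empty).  For a function that is not
   Lipschitz, [sup] returns the junk value 0, so [lipnorm] is meaningful only
   together with membership in [Lip0 X]. *)
Definition lipnorm (R : realType) (X : normedModType R) (f : X -> R) : R :=
  sup [set r | exists x y : X, x != y /\ r = `|f x - f y| / `|x - y|].

(* Main.v *)
(* With t = sqrt(2 d) / 2 for some d < delta still satisfying
   (f x - f y) / |x - y| > 1 - d, take q = f + t h and g = q / ||q||.
   The pair (x, y) shows ||q|| > 1 - d + t, where d = 2 t^2 < 2 t, and
   ||q|| <= 1 + t, so ||f - g|| <= t + | ||q|| - 1 | <= 2 t.  Since the slopes
   of f are at most 1, a pair on which q has slope > 1 - d + t must have
   h-slope > 1 - d / t = 1 - 2 t; any pairs whose q-slopes tend to ||q||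
   and exceed that threshold do the job. *)
Require Import Defs.
From mathcomp Require Import all_boot all_order all_algebra.
From mathcomp Require Import all_classical all_reals all_analysis.
From mathcomp Require Import ring lra.

Import Order.TTheory GRing.Theory Num.Theory.
Import numFieldNormedType.Exports.

Local Open Scope classical_set_scope.
Local Open Scope ring_scope.

Lemma lipschitzP (R : realType) (X : normedModType R) (f : X -> R) :
  lipschitz f <-> exists M : R, forall a b, `|f a - f b| <= M * `|a - b|.
Proof.
split=> [[M [_ fM]]|[M fM]].
  (* [lipschitz] gives the bound only for constants strictly above [M], hence the shift by one. *)
  exists (M + 1) => a b.
  by apply: (fM (M + 1) _ (a, b)) => //; rewrite ltrDl.
exists M; split; first exact: num_real.
move=> k Mk [a b] _ /=.
by apply: (le_trans (fM a b)); rewrite ler_wpM2r// ltW.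
Qed.

Lemma lipnorm_ub (R : realType) (X : normedModType R) (f : X -> R) (a b : X) :
  lipschitz f -> `|f a - f b| <= lipnorm f * `|a - b|.
Proof.
move=> /lipschitzP[M fM].
have [->|ab] := eqVneq a b; first by rewrite !subrr !normr0 mulr0.
rewrite -ler_pdivrMr ?normr_gt0 ?subr_eq0//.
apply: ub_le_sup; last by exists a, b.
exists M => _ [v [w [vw ->]]].
by rewrite ler_pdivrMr ?normr_gt0 ?subr_eq0.
Qed.

Lemma slope_le_lipnorm (R : realType) (X : normedModType R) (f : X -> R)
    (a b : X) :
  lipschitz f -> a != b -> (f a - f b) / `|a - b| <= lipnorm f.
Proof.
move=> lf ab; rewrite ler_pdivrMr ?normr_gt0 ?subr_eq0//.
exact: le_trans (ler_norm _) (lipnorm_ub _ _ _ a b lf).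
Qed.

Section NontrivialSpace.
Context {R : realType} {X : normedModType R} {x y : X}.
Hypothesis xy : x != y.

(** The pair [x], [y] makes the set of slopes nonempty. In the zero space [lipnorm f] is 0, and a
    negative [M] would be a counterexample. *)
Lemma lipnorm_le (f : X -> R) (M : R) :
  (forall a b, `|f a - f b| <= M * `|a - b|) -> lipnorm f <= M.
Proof.
move=> fM; apply: ge_sup; first by exists (`|f x - f y| / `|x - y|), x, y.
move=> _ [v [w [vw ->]]].
by rewrite ler_pdivrMr ?normr_gt0 ?subr_eq0.
Qed.

(** Swapping the two points flips the sign of the slope, so the supremum of absolute slopes is also
    approached by signed ones. *)
Lemma lipnorm_approx (f : X -> R) (r : R) :
  r < lipnorm f -> exists v w, v != w /\ r < (f v - f w) / `|v - w|.
Proof.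
move=> /sup_gt[|_ [v [w [vw ->]]] rf].
  by exists (`|f x - f y| / `|x - y|), x, y.
have [fvw|fvw] := leP 0 (f v - f w).
  by exists v, w; rewrite -{1}(ger0_norm fvw).
exists w, v; rewrite eq_sym distrC; split=> //.
by rewrite -opprB -(ltr0_norm fvw).
Qed.

End NontrivialSpace.

Theorem lemma4p1 (R : realType) (X : completeNormedModType R)
    (f : X -> R) (delta : R) (x y : X)
    (hf : Lip0 X f) (hf1 : lipnorm f = 1)
    (hdelta : 0 < delta < 2)
    (hxy : x <> y)
    (hfxy : (f x - f y) / `|x - y| > 1 - delta) :
  forall h : X -> R, Lip0 X h -> lipnorm h = 1 ->
    (h x - h y) / `|x - y| = 1 ->
  exists (g : X -> R) (v w : nat -> X),
    [/\ Lip0 X g,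
        lipnorm g = 1,
        lipnorm (fun z => f z - g z) < Num.sqrt (2 * delta),
        (forall n, v n <> w n)
      & (forall n, (h (v n) - h (w n)) / `|v n - w n|
                     > 1 - Num.sqrt (2 * delta)) /\
        (fun n => (g (v n) - g (w n)) / `|v n - w n|) @ \oo --> (1 : R) ].
Proof.
move=> h [hL h0] hn hhxy; case: hf => fL f0; move/eqP: hxy => xy.
have f_slope a b : a != b -> (f a - f b) / `|a - b| <= 1.
  by rewrite -hf1; exact: slope_le_lipnorm.
have f_lip a b : `|f a - f b| <= `|a - b|.
  by rewrite -[leRHS]mul1r -hf1; exact: lipnorm_ub.
have h_lip a b : `|h a - h b| <= `|a - b|.
  by rewrite -[leRHS]mul1r -hn; exact: lipnorm_ub.
have fxy1 := f_slope _ _ xy.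
(* The midpoint of [delta] and [1 - (f x - f y) / |x - y|]: the room left below [delta] makes the
   final norm bound strict. *)
pose d := (delta + (1 - (f x - f y) / `|x - y|)) / 2.
have d_lt : d < delta by rewrite /d; lra.
have d_gt0 : 0 < d by rewrite /d; lra.
have f_d : 1 - d < (f x - f y) / `|x - y| by rewrite /d; lra.
pose t := Num.sqrt (2 * d) / 2.
have t_gt0 : 0 < t by rewrite /t divr_gt0// sqrtr_gt0; lra.
have dE : d = 2 * t ^+ 2.
  have : Num.sqrt (2 * d) ^+ 2 = 2 * d by rewrite sqr_sqrtr//; lra.
  by rewrite /t => s2; rewrite exprMn s2; field.
have t_eps : 2 * t < Num.sqrt (2 * delta).
  rewrite /t [2 * _]mulrC divfK// ltr_sqrt; lra.
clearbody t.
(* [t >= 1] would force [d >= 2 > delta]. Hence [d < 2 * t], which later yields [N > 1 - t > 0]. *)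
have t_lt1 : t < 1 by rewrite ltNge; apply/negP => t1; nra.
pose q z := f z + t * h z.
have q_slope a b : (q a - q b) / `|a - b| =
    (f a - f b) / `|a - b| + t * ((h a - h b) / `|a - b|).
  by rewrite /q; ring.
have q_lip a b : `|q a - q b| <= (1 + t) * `|a - b|.
  have -> : q a - q b = (f a - f b) + t * (h a - h b) by rewrite /q; ring.
  rewrite (le_trans (ler_normD _ _))// normrM (gtr0_norm t_gt0) mulrDl mul1r.
  by rewrite lerD// ler_pM2l.
have qL : lipschitz q by apply/lipschitzP; exists (1 + t).
pose N := lipnorm q.
have N_gt : 1 - d + t < N.
  apply: (lt_le_trans _ (slope_le_lipnorm _ _ _ x y qL xy)).
  by rewrite q_slope hhxy mulr1 ltrD2r.
have N_le : N <= 1 + t := lipnorm_le xy _ _ q_lip.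
have N_gt0 : 0 < N by apply: lt_trans N_gt; nra.
pose g z := q z / N.
have gB a b : g a - g b = (q a - q b) / N by rewrite /g mulrBl.
have g_lip a b : `|g a - g b| <= 1 * `|a - b|.
  rewrite gB normrM normfV (gtr0_norm N_gt0) mul1r ler_pdivrMr// mulrC.
  exact: lipnorm_ub.
have gL : lipschitz g by apply/lipschitzP; exists 1.
have g1 : lipnorm g = 1.
  apply/eqP; rewrite eq_le (lipnorm_le xy _ _ g_lip)/=.
  (* For [1 <= lipnorm g]: [N * lipnorm g] is a Lipschitz constant of [q = N g], so it is at least
     [N]. *)
  rewrite -(ler_pM2l N_gt0) mulr1; apply: (lipnorm_le xy) => a b.
  have -> : q a - q b = N * (g a - g b).
    by rewrite gB mulrCA divff ?gt_eqF ?mulr1.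
  by rewrite normrM (gtr0_norm N_gt0) -mulrA ler_pM2l// lipnorm_ub.
have fg_lip a b : `|(f a - g a) - (f b - g b)| <= 2 * t * `|a - b|.
  (* Since [f = N g - t h], both terms are [t]-Lipschitz once [|N - 1| <= t], which follows from
     [N_gt], [N_le] and [t_lt1]. *)
  have -> : (f a - g a) - (f b - g b) =
      (N - 1) * (g a - g b) - t * (h a - h b).
    by rewrite /g /q; field; rewrite gt_eqF.
  apply: le_trans (ler_normB _ _) _; rewrite !normrM (gtr0_norm t_gt0).
  have -> : 2 * t * `|a - b| = t * `|a - b| + t * `|a - b| by ring.
  rewrite lerD ?(ler_pM2l t_gt0)//.
  have := g_lip a b; rewrite mul1r => gab; apply: ler_pM => //.
  by rewrite ler_norml; apply/andP; split; nra.
(* The gap between [N] and the threshold. As [harmonic n = 1 / (n + 1) <= 1], the bound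
   [N - eta * harmonic n] stays above the threshold from [n = 0] on and tends to [N]. *)
pose eta := N - (1 - d + t).
have eta_gt0 : 0 < eta by rewrite subr_gt0.
have approx n : exists p : X * X, p.1 != p.2 /\
    N - eta * harmonic n < (q p.1 - q p.2) / `|p.1 - p.2|.
  have [|v [w vw]] := lipnorm_approx xy q (N - eta * harmonic n).
    by rewrite ltrBlDr ltrDl mulr_gt0// harmonic_gt0.
  by exists (v, w).
have [p pP] := choice approx.
exists g, (fun n => (p n).1), (fun n => (p n).2); split.
- by split=> //; rewrite /g /q f0 h0 mulr0 addr0 mul0r.
- exact: g1.
- exact: le_lt_trans (lipnorm_le xy _ _ fg_lip) t_eps.
- by move=> n; apply/eqP; case: (pP n).
split=> [n|].
  have [pn qn] := pP n; have := f_slope _ _ pn.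
  have h1 : harmonic n <= 1 :> R by rewrite invf_le1// ler1n.
  move: qn; rewrite q_slope.
  move: ((f _ - _) / _) ((h _ - _) / _) => F H qn F1.
  have : eta * harmonic n <= eta by rewrite ler_piMr// ltW.
  (* From [F + t * H > 1 - d + t] and [F <= 1]; as [t - d = t * (1 - 2 * t)], dividing by [t] gives
     [H > 1 - 2 * t]. *)
  rewrite {2}/eta => en; have tH : t - d < t * H by lra.
  apply: (@lt_trans _ _ (1 - 2 * t)); first by rewrite ltrD2l ltrN2.
  by rewrite -(ltr_pM2l t_gt0); nra.
(* The lower bound is the one on the slopes of [q], divided by [N]; the upper bound is
   [lipnorm g = 1]. *)
apply: (@squeeze_cvgr _ _ _ _ (fun n => 1 - eta / N * harmonic n) (fun=> 1)).
- apply: nearW => n; have [pn qn] := pP n; apply/andP; split.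
    rewrite gB [leRHS]mulrAC ler_pdivlMr//; apply: le_trans (ltW qn).
    by rewrite mulrBl mul1r mulrAC divfK// gt_eqF.
  by rewrite -g1; exact: slope_le_lipnorm.
- rewrite -[X in _ --> X]subr0 -(mulr0 (eta / N)).
  by apply: cvgB; [exact: cvg_cst|apply: cvgMr; exact: cvg_harmonic].
- exact: cvg_cst.
Qed.
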